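(* For every integer $k\ge 0$ there is a universal polynomial $Q_k\in\mathbb{Q}[u_1,\ldots,u_k,z_1,\ldots,z_k]$ (depending only on $k$, not on $n$ or $d$) such that, for all integers $n\ge 1$ and $d\ge 0$, $$c_k(n,d)=Q_k\bigl(T_1(n,d),\ldots,T_k(n,d);\,e_1,\ldots,e_k\bigr),\qquad T_r(n,d):=\binom{d+n-1}{n+r-1}\quad(1\le r\le k).$$ Equivalently, in the expansion $c_k(n,d)=\sum_{\lambda\vdash k}f_\lambda(n,d)\,e_\lambda$ one has $f_\lambda(n,d)\in\mathbb{Q}[T_1(n,d),\ldots,T_k(n,d)]$ for every partition $\lambda\vdash k$; that is, for each $\lambda\vdash k$ there is a polynomial $g_\lambda\in\mathbb{Q}[u_1,\ldots,u_k]$, independent of $n$ and $d$, with $f_\lambda(n,d)=g_\lambda(T_1(n,d),\ldots,T_k(n,d))$. In particular, each $f_\lambda(n,d)$ is a polynomial in finitely many binomial coefficients of the form $\binom{d+n+a}{n+b}$ (with $a,b$ integers independent of $n,d$).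
   Context: For integers $n\ge1$, $d\ge0$ let $A_{n,d}=\{\alpha\in\mathbb{Z}_{\ge0}^n:\alpha_1+\cdots+\alpha_n=d\}$. Let $x_1,\ldots,x_n$ be indeterminates. $c_k(n,d)\in\mathbb{Z}[x_1,\ldots,x_n]$ is the homogeneous degree-$k$ part of $$\prod_{\alpha\in A_{n,d}}(1+\alpha_1x_1+\cdots+\alpha_nx_n)$$ (the $k$-th Chern class of $\mathrm{Sym}^d(\mathbb{C}^n)$); it is a symmetric polynomial. $e_i=e_i(x_1,\ldots,x_n)$ is the $i$-th elementary symmetric polynomial (so $e_i=0$ for $i>n$), and $e_\lambda=e_{\lambda_1}\cdots e_{\lambda_\ell}$ for a partition $\lambda=(\lambda_1,\ldots,\lambda_\ell)$. Binomial coefficients $\binom{a}{b}$ with $0\le a<b$ are $0$. (When $n<k$ the $e_\lambda$, $\lambda\vdash k$, are not linearly independent; the expansion statement then means that the identity $c_k(n,d)=\sum_\lambda g_\lambda(T_1,\dots,T_k)e_\lambda$ holds with the universal $g_\lambda$.) *)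

(* Defs.v *)
From mathcomp Require Import all_boot all_order all_algebra.
From mathcomp.multinomials Require Import mpoly.

Set Implicit Arguments.
Unset Strict Implicit.
Unset Printing Implicit Defensive.

Import GRing.Theory.
Local Open Scope ring_scope.

(* [c_k(n,d)].  The index set A_{n,d} is the set of exponent vectors
   alpha : 'X_{1..n} of total degree [mdeg alpha] equal to d; the bound d.+1
   only serves to make the range of the product finite. *)
Definition chern_sym (n d k : nat) : {mpoly int[n]} :=
  pihomog mdeg k
    (\prod_(alpha : 'X_{1..n < d.+1} | mdeg alpha == d)
       (1 + \sum_(i < n) (alpha i)%:R *: 'X_i)).

Definition chern_symQ (n d k : nat) : {mpoly rat[n]} :=
  map_mpoly intr (chern_sym n d k).

(* Used only for n >= 1, where the truncated subtractions are exact. *)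
Definition Tbin (n d r : nat) : rat := 'C(d + n - 1, n + r - 1)%:R.

(* Index i : 'I_k stands for r = i + 1. *)
Definition Tvec (n d k : nat) (i : 'I_k) : rat := Tbin n d i.+1.

(* What is substituted for the variables (u_1, ..., u_k, z_1, ..., z_k):
   the constants T_1, ..., T_k, then e_1, ..., e_k. *)
Definition Te_tuple (n d k : nat) : (k + k).-tuple {mpoly rat[n]} :=
  [tuple match split j with
         | inl i => (Tvec n d i)%:MP
         | inr i => mesym n rat i.+1
         end | j < k + k].

(* A partition of k has at most k parts, all at most k; these bounds make
   the type finite, so that sums over all partitions of k make sense. *)
Definition is_intpart (k : nat) (s : seq nat) : bool :=
  [&& sorted geq s, all (leq 1) s & sumn s == k].

Definition intpart (k : nat) : Type :=
  {s : k.-bseq 'I_k.+1 | is_intpart k (map val s)}.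

Definition parts (k : nat) (lam : intpart k) : seq nat := map val (val lam).

Definition e_part (n k : nat) (lam : intpart k) : {mpoly rat[n]} :=
  \prod_(i <- parts lam) mesym n rat i.

Definition e_expansion (n d k : nat) (f : intpart k -> rat) : Prop :=
  chern_symQ n d k = \sum_(lam : intpart k) f lam *: e_part n lam.

(* Main.v *)
Require Import Defs.
From mathcomp Require Import all_boot all_order all_algebra.
From mathcomp Require Import zify.
From mathcomp.multinomials Require Import mpoly.

Set Implicit Arguments.
Unset Strict Implicit.
Unset Printing Implicit Defensive.

Import GRing.Theory.
Local Open Scope ring_scope.

(* A product F(t) of power series with F(0) = 1 and its logarithmic derivative
   P = F'/F determine each other by (k+1) F_{k+1} = sum_j F_{k-j} P_j, so the
   coefficients of F are universal polynomials in the T_r and e_i as soon as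
   those of P are, and conversely.  This is used three times.
   - For F = prod_i (1 + x_i t): the power sums of the x_i are universal.
   - Let E = exp - 1.  As exp(a x t) = sum_c 'C(a, c) E(x t)^c, and as
     sum_(alpha in A_{n,d}) prod_i 'C(alpha_i, c_i) = 'C(d+n-1, n-1+|c|),
     the power sum sum_alpha (alpha.x)^m is m! times the coefficient of t^m in
     F = prod_i (sum_c u^c E(x_i t)^c), with u^r replaced by T_r.  The
     logarithmic derivative of F only involves u and the power sums of the x_i.
     For m >= 1 the powers of u that occur are u, ..., u^m.
   - For F = prod_alpha (1 + (alpha.x) t): the c_k are universal.
   The coefficient of e_lambda is then read off from the part of weight k, and
   for n >= k it is unique by the algebraic independence of the e_i. *)

(** * Logarithmic derivatives and universal families *)

(* [P] is the truncation of [F' / F]. *)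
Definition is_logder (A : comNzRingType) (K : nat) (F P : {poly A}) : Prop :=
  forall k, (k < K)%N -> (F^`())`_k = (F * P)`_k.

Section LogDer.
Variable A : comNzRingType.
Implicit Types F G P Q : {poly A}.

Lemma coefM_eq_low F G G' k :
  (forall j, (j <= k)%N -> G`_j = G'`_j) -> (F * G)`_k = (F * G')`_k.
Proof.
by move=> eqG; rewrite !coefM; apply: eq_bigr => j _; rewrite eqG ?leq_subr.
Qed.

Lemma is_logder1 K : is_logder K (1 : {poly A}) 0.
Proof. by move=> k _; rewrite derivE mulr0 coef0. Qed.

Lemma is_logderM K F P G Q :
  is_logder K F P -> is_logder K G Q -> is_logder K (F * G) (P + Q).
Proof.
move=> hF hG k ltkK; have lt j : (j <= k)%N -> (j < K)%N by move/leq_ltn_trans->.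
rewrite derivM coefD mulrDr coefD; congr (_ + _).
  rewrite [F * G * P]mulrAC ![_ * G]mulrC; apply: coefM_eq_low => j /lt; exact: hF.
by rewrite -mulrA; apply: coefM_eq_low => j /lt; apply: hG.
Qed.

Lemma is_logder_prod (J : finType) (S : pred J) K (F P : J -> {poly A}) :
  (forall i, S i -> is_logder K (F i) (P i)) ->
  is_logder K (\prod_(i | S i) F i) (\sum_(i | S i) P i).
Proof.
move=> h; apply: (big_ind2 (is_logder K)) => //; first exact: is_logder1.
by move=> *; apply: is_logderM.
Qed.

(** The coefficients of [P] are solved for one at a time; each enters its equation multiplied by the
    constant term 1 of [F], so no division occurs. *)
Lemma is_logder_exists K F : F`_0 = 1 -> exists P, is_logder K F P.
Proof.
move=> F0; elim: K => [|K [P hP]]; first by exists 0.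
pose c := F^`()`_K - (F * P)`_K; exists (P + c%:P * 'X^K) => k.
rewrite ltnS mulrDr coefD mulrA coefMXn leq_eqVlt => /orP[/eqP->|ltkK].
  by rewrite ltnn subnn coefMC F0 mul1r addrC subrK.
by rewrite ltkK addr0; apply: hP.
Qed.

(** Replacing [t] by [x t] changes [F'/F] from [P(t)] to [x P(x t)], whence the exponent [j.+1]. *)
Lemma is_logder_scale K F P x : is_logder K F P ->
  is_logder K (\poly_(j < K.+1) (F`_j * x ^+ j))
              (\poly_(j < K) (P`_j * x ^+ j.+1)).
Proof.
move=> h k ltkK; have := h k ltkK.
rewrite !coef_deriv coef_poly ltnS ltkK -mulrnAl => ->.
rewrite !coefM mulr_suml; apply: eq_bigr => j _.
have lejk : (j <= k)%N by rewrite -ltnS.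
rewrite !coef_poly ltnS (leq_trans lejk (ltnW ltkK)).
rewrite (leq_ltn_trans (leq_subr j k) ltkK).
rewrite mulrACA -exprD addnS subnKC //.
Qed.

Lemma is_logder_1DX K (x : A) :
  is_logder K (1 + x *: 'X) (\poly_(j < K) ((-1) ^+ j * x ^+ j.+1)).
Proof.
move=> k ltkK; rewrite !derivE add0r mulrDl mul1r -scalerAl coefD !coefZ coefXM.
rewrite !coef_poly ltkK; case: k ltkK => [|k] ltkK.
  by rewrite coef1 mulr0 addr0 mul1r mulr1.
rewrite coef1 /= mulr0 (ltnW ltkK) exprS mulN1r mulNr [x * _]mulrCA -exprS addNr //.
Qed.

End LogDer.

Lemma is_logder_map (A A' : comNzRingType) (f : {rmorphism A -> A'}) K F P :
  is_logder K F P -> is_logder K (map_poly f F) (map_poly f P).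
Proof.
by move=> h k ltkK; rewrite deriv_map -rmorphM !coef_map /= h.
Qed.

Section Universal.
Variables (I : Type) (A : I -> comNzRingType) (B : comNzRingType).
Variable ev : forall i, {rmorphism B -> A i}.

(** [B] is the ring of formal polynomials and [ev i] the evaluation at the parameter [i]; a single
    [b] serves all [i], although the target ring varies. *)
Definition universal (F : forall i, A i) : Prop := exists b, forall i, F i = ev i b.

Lemma eq_universal F G : (forall i, F i = G i) -> universal F -> universal G.
Proof. by move=> eqFG [b hb]; exists b => i; rewrite -eqFG. Qed.

Lemma universalC b : universal (fun i => ev i b).
Proof. by exists b. Qed.

Lemma universal0 : universal (fun i => 0).
Proof. by exists 0 => i; rewrite rmorph0. Qed.

Lemma universal1 : universal (fun i => 1).
Proof. by exists 1 => i; rewrite rmorph1. Qed.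

Lemma universalD F G : universal F -> universal G -> universal (fun i => F i + G i).
Proof. by move=> [b hb] [c hc]; exists (b + c) => i; rewrite hb hc rmorphD. Qed.

Lemma universalN F : universal F -> universal (fun i => - F i).
Proof. by move=> [b hb]; exists (- b) => i; rewrite hb rmorphN. Qed.

Lemma universalM F G : universal F -> universal G -> universal (fun i => F i * G i).
Proof. by move=> [b hb] [c hc]; exists (b * c) => i; rewrite hb hc rmorphM. Qed.

Lemma universalMn F m : universal F -> universal (fun i => F i *+ m).
Proof. by move=> [b hb]; exists (b *+ m) => i; rewrite hb rmorphMn. Qed.

Lemma universal_sum m (F : 'I_m -> forall i, A i) :
  (forall j, universal (F j)) -> universal (fun i => \sum_(j < m) F j i).
Proof.
elim: m F => [|m IH] F hF.
  by apply: eq_universal universal0 => i; rewrite big_ord0.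
apply: eq_universal (universalD (IH (fun j => F (widen_ord (leqnSn m) j)) _) (hF ord_max)).
  by move=> i; rewrite big_ord_recr.
by move=> j; apply: hF.
Qed.

Variables (K : nat) (F P : forall i, {poly A i}).
Hypothesis logder_FP : forall i, is_logder K (F i) (P i).
Hypothesis F0 : forall i, (F i)`_0 = 1.

(** The recursion is solved for the last coefficient of [P], whose factor is the constant term 1 of
    [F]. *)
Lemma universal_logder :
  (forall k, (k <= K)%N -> universal (fun i => (F i)`_k)) ->
  forall k, (k < K)%N -> universal (fun i => (P i)`_k).
Proof.
move=> hF k; have [m] := ubnP k; elim: m k => // m IH k; rewrite ltnS => lekm ltkK.
pose G i := (F i)`_k.+1 *+ k.+1 - \sum_(j < k) (F i)`_(k - j) * (P i)`_j.
apply: (@eq_universal G) => [i|].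
  by rewrite /G -coef_deriv logder_FP // coefMr big_ord_recr /= subnn F0 mul1r [X in X - _]addrC addrK.
apply: (@universalD (fun i => _) (fun i => _)); first exact: universalMn (hF _ ltkK).
apply: (@universalN (fun i => _)).
apply: (@universal_sum _ (fun j i => (F i)`_(k - j) * (P i)`_j)) => j.
apply: (@universalM (fun i => (F i)`_(k - j)) (fun i => (P i)`_j)).
  by apply: hF; apply: leq_trans (leq_subr _ _) (ltnW ltkK).
by apply: IH; [apply: leq_trans lekm | apply: ltn_trans ltkK].
Qed.

Hypothesis natr_invertible : forall m, exists b : B, b * m.+1%:R = 1.

(** Here the unknown coefficient of [F] carries the factor [k.+1], which [natr_invertible] allows to
    divide out inside [B]. *)
Lemma universal_of_logder :
  (forall k, (k < K)%N -> universal (fun i => (P i)`_k)) ->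
  forall k, (k <= K)%N -> universal (fun i => (F i)`_k).
Proof.
move=> hP k; have [m] := ubnP k; elim: m k => // m IH [_ _|k].
  by apply: eq_universal universal1 => i; rewrite F0.
rewrite ltnS => ltkm ltkK; have [b hb] := natr_invertible k.
apply: (@eq_universal (fun i => ev i b * \sum_(j < k.+1) (F i)`_(k - j) * (P i)`_j)) => [i|].
  rewrite -coefMr -logder_FP // coef_deriv -mulr_natl mulrA.
  by rewrite -(rmorph_nat (ev i)) -rmorphM hb rmorph1 mul1r.
apply: (@universalM (fun i => ev i b)); first exact: universalC.
apply: (@universal_sum _ (fun j i => (F i)`_(k - j) * (P i)`_j)) => j.
have lejk : (j <= k)%N by rewrite -ltnS.
apply: (@universalM (fun i => (F i)`_(k - j)) (fun i => (P i)`_j)); last by apply: hP; apply: leq_ltn_trans ltkK.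
apply: IH; first exact: leq_ltn_trans (leq_subr _ _) ltkm.
exact: leq_trans (leq_subr _ _) (ltnW ltkK).
Qed.

End Universal.

(** * The functional sending powers of u to binomial coefficients *)

(** Among [M.+1] points, choose [a + b + 1] and let [j] be the position of the chosen point with
    exactly [a] chosen points before it. *)
Lemma sum_bin_mul M a b :
  (\sum_(j < M.+1) 'C(j, a) * 'C(M - j, b) = 'C(M.+1, a + b.+1))%N.
Proof.
elim: M b => [|M IH] b.
  by rewrite big_ord1 subnn; case: a b => [|a] [|b] //; rewrite !addnS [RHS]bin_small.
rewrite big_ord_recr /= subnn; case: b => [|b].
  rewrite bin0 muln1 addn1 binS -{1}(addn1 a) -IH; congr addn.
  by apply: eq_bigr => j _; rewrite !bin0.
rewrite muln0 addn0 addnS binS -{1}addnS -!IH -big_split /=.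
apply: eq_bigr => j _; rewrite subSn ?binS ?mulnDr //.
by rewrite -ltnS.
Qed.

Section BinomialFunctional.
Variable A : comNzRingType.
Implicit Types p q : {poly A}.

Lemma coef_1DXn M j : ((1 + 'X : {poly A}) ^+ M)`_j = 'C(M, j)%:R.
Proof.
rewrite addrC exprDn coef_sum.
under eq_bigr => i _ do rewrite expr1n mulr1 coefMn coefXn.
have [ltMj|lejM] := ltnP M j.
  rewrite bin_small // big1 // => i _.
  by rewrite gtn_eqF ?mul0rn // (leq_ltn_trans (leq_subr _ _)).
rewrite -bin_sub // (bigD1 (Ordinal (leq_subr j M : (M - j < M.+1)%N))) //=.
rewrite subKn // eqxx big1 ?addr0 // => i nei.
case: eqP => [eqj|]; last by rewrite mul0rn.
by case/eqP: nei; apply: val_inj; rewrite /= eqj subKn // -ltnS.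
Qed.

(* The linear functional sending ['X^r] to ['C(d + n, n + r)], i.e. to [T_r]
   for n + 1 variables. *)
Definition binfun (n d : nat) p : A := (p * (1 + 'X) ^+ (d + n))`_d.

Lemma binfunXn n d r : binfun n d 'X^r = 'C(d + n, n + r)%:R.
Proof.
rewrite /binfun coefXnM coef_1DXn; case: ltnP => [ltdr|lerd].
  by rewrite bin_small // addnC ltn_add2l.
by rewrite -(@bin_sub (d + n) (n + r)); [congr ('C(_, _)%:R); lia | lia].
Qed.

Lemma binfunD n d : {morph @binfun n d : p q / p + q}.
Proof. by move=> p q; rewrite /binfun mulrDl coefD. Qed.

Lemma binfunZ n d c p : binfun n d (c *: p) = c * binfun n d p.
Proof. by rewrite /binfun -scalerAl coefZ. Qed.

Lemma binfun_sum n d (J : Type) (r : seq J) (S : pred J) (F : J -> {poly A}) :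
  binfun n d (\sum_(j <- r | S j) F j) = \sum_(j <- r | S j) binfun n d (F j).
Proof. by rewrite /binfun mulr_suml coef_sum. Qed.

Lemma binfunE n d p N : (size p <= N)%N ->
  binfun n d p = \sum_(r < N) p`_r * 'C(d + n, n + r)%:R.
Proof.
move=> leN; have -> : p = \poly_(r < N) p`_r.
  apply/polyP => r; rewrite coef_poly; case: ltnP => // leNr.
  by rewrite nth_default // (leq_trans leN).
rewrite poly_def binfun_sum; apply: eq_bigr => r _.
by rewrite binfunZ binfunXn -poly_def coef_poly ltn_ord.
Qed.

(** By bilinearity it suffices to take powers of ['X] for [p] and [q], where the identity is
    [sum_bin_mul]. *)
Lemma binfunM n d p q :
  \sum_(j < d.+1) binfun 0 j p * binfun n (d - j) q = binfun n.+1 d (p * q).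
Proof.
rewrite -[p]coefK -[q]coefK !poly_def mulr_suml binfun_sum.
under eq_bigr => j _ do rewrite !binfun_sum mulr_suml.
rewrite exchange_big; apply: eq_bigr => a _ /=.
rewrite mulr_sumr binfun_sum.
under eq_bigr => j _ do rewrite mulr_sumr.
rewrite exchange_big; apply: eq_bigr => b _ /=.
rewrite -scalerAl -scalerAr -exprD !binfunZ binfunXn.
under eq_bigr => j _ do rewrite !binfunZ !binfunXn mulrACA addn0 add0n -natrM.
rewrite -mulr_sumr -natr_sum mulrA; congr (_ * _%:R).
have -> : (d + n.+1 = (d + n).+1)%N by lia.
have -> : (n.+1 + (a + b) = a + (n + b).+1)%N by lia.
rewrite -sum_bin_mul -addSn -!(big_mkord xpredT (fun j => 'C(j, a) * 'C(d + n - j, n + b))%N).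
(* The sum in [sum_bin_mul] runs up to [d + n]; its terms with [j > d] vanish because then
   [d + n - j < n + b]. *)
rewrite (@big_cat_nat _ _ _ d.+1) //= ?ltnS ?leq_addr // [RHS]addnC big_nat_cond.
rewrite [in RHS]big1 ?add0n => [|j /andP[/andP[ltdj ltj] _]].
  by rewrite big_mkord; apply: eq_bigr => j _; rewrite addnBAC // -ltnS.
by rewrite (@bin_small (d + n - j)) ?muln0 //; lia.
Qed.

Lemma coef_prod_poly n N m (E : 'I_n -> nat -> A) :
  (\prod_(i < n) \poly_(j < N.+1) E i j)`_m =
  \sum_(f : {ffun 'I_n -> 'I_N.+1} | (\sum_i f i == m)%N) \prod_i E i (f i).
Proof.
under eq_bigr => i _ do rewrite poly_def.
rewrite bigA_distr_bigA coef_sum [RHS]big_mkcond; apply: eq_bigr => f _.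
rewrite scaler_prod prodrXr coefZ coefXn eq_sym.
by case: eqP => _; rewrite ?mulr1 ?mulr0.
Qed.

(** Iterating [binfunM] over the variables sums over all ways of writing [d] as an ordered sum of
    [n.+1] naturals. *)
Lemma coef_prod_binfun n d N (q : 'I_n.+1 -> {poly A}) : (d <= N)%N ->
  (\prod_(i < n.+1) \poly_(j < N.+1) binfun 0 j (q i))`_d =
  binfun n d (\prod_(i < n.+1) q i).
Proof.
elim: n d q => [|n IH] d q ledN; first by rewrite !big_ord1 coef_poly ltnS ledN.
rewrite !(big_ord_recl n.+1) -binfunM coefM; apply: eq_bigr => j _.
rewrite coef_poly (leq_trans (ltn_ord j)) // IH // (leq_trans (leq_subr _ _)) //.
Qed.

End BinomialFunctional.

Lemma binfun_map (A A' : comNzRingType) (f : {rmorphism A -> A'}) n d p :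
  binfun n d (map_poly f p) = f (binfun n d p).
Proof.
by rewrite /binfun -coef_map rmorphM rmorphXn rmorphD rmorph1 /= map_polyX.
Qed.

(** The coefficient of ['X^c] is [c!] times the Stirling number [S(j, c)], so this is [j!] times the
    coefficient of [t^j] in [\sum_c u^c (exp t - 1)^c]. The recursion encodes [a 'C(a, c) = c 'C(a,
    c) + (c + 1) 'C(a, c + 1)]. *)
Fixpoint powpoly (j : nat) : {poly rat} :=
  if j is i.+1 then
    \sum_(c < j) (powpoly i)`_c *: ((nat_of_ord c)%:R *: 'X^c + c.+1%:R *: 'X^(c.+1))
  else 1.

Lemma size_powpoly j : (size (powpoly j) <= j.+1)%N.
Proof.
case: j => [|j] /=; first by rewrite size_poly1.
apply: (leq_trans (size_sum _ _ _)); apply/bigmax_leqP => c _.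
apply: (leq_trans (size_scale_leq _ _)); apply: (leq_trans (size_polyD _ _)).
rewrite geq_max !(leq_trans (size_scale_leq _ _)) // size_polyXn ltnS.
  by rewrite ltn_ord.
by rewrite ltnW // ltnS.
Qed.

Lemma coef0_powpoly j : (powpoly j)`_0 = (j == 0)%:R.
Proof.
case: j => [|j] /=; first by rewrite coef1.
rewrite coef_sum big1 // => c _; rewrite coefZ coefD !coefZ !coefXn mulr0 addr0.
by case: c => -[|c] /= _; rewrite ?mul0r ?mulr0.
Qed.

(* I.e. [a ^ j = \sum_c (powpoly j)`_c * 'C(a, c)]. *)
Lemma binfun_powpoly j a : binfun 0 a (powpoly j) = a%:R ^+ j.
Proof.
elim: j => [|j IH]; first by rewrite /binfun mul1r coef_1DXn addn0 binn.
rewrite exprS -IH (binfunE _ _ (size_powpoly j)) mulr_sumr binfun_sum.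
apply: eq_bigr => c _.
rewrite binfunZ binfunD !binfunZ !binfunXn mulrCA; congr (_ * _).
rewrite !addn0 !add0n -!natrM -natrD mul_bin_left -mulnDl.
(* The difference [a - c] is truncated, but where this matters the binomial coefficient is 0. *)
have [lta|lea] := ltnP a c; first by rewrite bin_small // !muln0.
by rewrite subnKC.
Qed.

(** * Exponential generating series *)

Section PowerSums.
Variables (A : comAlgType rat) (K : nat).

Lemma fact_ratV m : m.+1%:R * (m.+1`!%:R)^-1 = (m`!%:R)^-1 :> rat.
Proof.
by rewrite factS natrM invfM mulrA mulfV ?mul1r // Num.Theory.pnatr_eq0.
Qed.

Lemma is_logder_exp (y : A) :
  is_logder K (\poly_(j < K.+1) (j`!%:R^-1 *: y ^+ j)) y%:P.
Proof.
move=> k ltkK; rewrite coef_deriv coefMC !coef_poly !ltnS ltkK (ltnW ltkK).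
by rewrite -scaler_nat scalerA fact_ratV -scalerAl -exprSr.
Qed.

(** A product of exponentials is the exponential of the sum: its logarithmic derivative is the
    constant [\sum_i y i], which determines the coefficients recursively. *)
Lemma coef_prod_exp n (y : 'I_n -> A) m : (m <= K)%N ->
  (\prod_(i < n) \poly_(j < K.+1) (j`!%:R^-1 *: y i ^+ j))`_m =
  m`!%:R^-1 *: (\sum_(i < n) y i) ^+ m.
Proof.
set F := \prod_(i < n) _ => lemK.
have hF : is_logder K F (\sum_(i < n) y i)%:P.
  by rewrite rmorph_sum; apply: is_logder_prod => i _; exact: is_logder_exp.
elim: m lemK => [_|m IH ltmK].
  rewrite expr0 fact0 invr1 scale1r /F.
  rewrite -horner_coef0 horner_prod big1 // => i _.
  by rewrite horner_coef0 coef_poly expr0 fact0 invr1 scale1r.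
have := hF m ltmK; rewrite coef_deriv coefMC IH ?(ltnW ltmK) // -scalerAl -exprSr.
rewrite -fact_ratV -scalerA -scaler_nat => /scalerI; apply.
by rewrite Num.Theory.pnatr_eq0.
Qed.

(* With [E = exp t - 1] one has [exp (a t) = \sum_c 'C(a, c) E ^ c], so that
   [binfun 0 a] maps [genser x], coefficientwise in [t], to the truncation of [exp (a x t)]. *)
Definition genser (x : A) : {poly {poly A}} :=
  \poly_(j < K.+1) ((j`!%:R^-1 *: x ^+ j) *: map_poly (in_alg A) (powpoly j)).

Lemma binfun_prod_powpoly n d (j : 'I_n.+1 -> nat) :
  binfun n d (\prod_i powpoly (j i)) =
  \sum_(f : {ffun 'I_n.+1 -> 'I_d.+1} | (\sum_i f i == d)%N)
     \prod_i (f i)%:R ^+ j i.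
Proof.
rewrite -(coef_prod_binfun _ (leqnn d)) coef_prod_poly.
by apply: eq_bigr => f _; apply: eq_bigr => i _; rewrite binfun_powpoly.
Qed.

(** A double sum over compositions [f] and exponent vectors [g] is taken in both orders: over [g]
    first, [coef_prod_exp] yields the power; over [f] first, [binfun_prod_powpoly] yields
    [binfun]. *)
Lemma sum_compositions_expr n d m (x : 'I_n.+1 -> A) : (m <= K)%N ->
  \sum_(f : {ffun 'I_n.+1 -> 'I_d.+1} | (\sum_i f i == d)%N)
     (\sum_i (f i)%:R * x i) ^+ m =
  m`!%:R * binfun n d (\prod_i genser (x i))`_m.
Proof.
move=> lemK.
rewrite coef_prod_poly binfun_sum.
under [in RHS]eq_bigr => g _.
  rewrite scaler_prod -rmorph_prod binfunZ binfun_map binfun_prod_powpoly rmorph_sum mulr_sumr.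
  over.
rewrite exchange_big mulr_sumr; apply: eq_bigr => f _ /=.
transitivity (m`!%:R * (m`!%:R^-1 *: (\sum_i (f i)%:R * x i) ^+ m)).
  rewrite -scalerAr mulr_natl -scaler_nat scalerA mulVf ?scale1r //.
  by rewrite Num.Theory.pnatr_eq0 -lt0n fact_gt0.
rewrite -coef_prod_exp // coef_prod_poly; congr (_ * _); apply: eq_bigr => g _.
rewrite -in_algE rmorph_prod -big_split; apply: eq_bigr => i _ /=.
rewrite exprMn -!scalerAl; congr (_ *: _).
by rewrite -in_algE rmorphXn rmorph_nat mulrC.
Qed.

(** Each factor has both properties, and they pass to products: degrees in [u] add, and at [u = 0]
    the series is 1. *)
Lemma coef_prod_genser n (x : 'I_n -> A) m :
  (size ((\prod_i genser (x i))`_m)%R <= m.+1)%N /\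
  (\prod_i genser (x i))`_m`_0 = (m == 0)%:R.
Proof.
pose D (F : {poly {poly A}}) :=
  forall m, (size (F`_m)%R <= m.+1)%N /\ F`_m`_0 = (m == 0)%:R.
suff: D (\prod_i genser (x i)) by apply.
apply: (big_ind D) => [k|F G hF hG k|i _ k].
- by rewrite coef1; case: k => [|k] /=; rewrite ?size_poly1 ?size_poly0 ?coef0 ?coef1.
- split.
    rewrite coefM; apply: (leq_trans (size_sum _ _ _)); apply/bigmax_leqP => j _.
    apply: leq_trans (size_polyMleq _ _) _.
    have [[sF _] [sG _]] := (hF j, hG (k - j)%N).
    have := ltn_ord j; lia.
  rewrite coefM coef_sum big_ord_recl /= subn0 coefM big_ord1.
  rewrite (hF 0).2 (hG k).2 mul1r big1 ?addr0 // => j _.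
  by rewrite coefM big_ord1 (hF _).2 mul0r.
rewrite coef_poly; case: ltnP => lek; last first.
  by rewrite size_poly0 coef0; case: k lek.
split; last first.
  rewrite coefZ coef_map coef0_powpoly; case: k {lek} => [|k].
    by rewrite expr0 fact0 invr1 scale1r mul1r; exact: (rmorph1 (in_alg A)).
  by rewrite raddf0 mulr0.
apply: leq_trans (size_scale_leq _ _) _.
by apply: leq_trans (size_poly _ _) (size_powpoly k).
Qed.

End PowerSums.

(** [genser K x] is one rational series [Phi] with [t] replaced by [x t]. So [Psi] is chosen before
    [x], and summing over several [x] produces only power sums. *)
Lemma logder_genser K : exists Psi : {poly {poly rat}},
  forall (A : comAlgType rat) (x : A),
  is_logder K (genser K x)
    (\poly_(j < K) (x ^+ j.+1 *: map_poly (in_alg A) Psi`_j)).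
Proof.
pose Phi : {poly {poly rat}} := \poly_(j < K.+1) (j`!%:R^-1 *: powpoly j).
have Phi0 : Phi`_0 = 1 by rewrite coef_poly fact0 invr1 scale1r.
have [Psi hPsi] := is_logder_exists K Phi0; exists Psi => A x.
have := is_logder_scale x%:P (is_logder_map (map_poly (in_alg A)) hPsi).
congr is_logder; apply: eq_poly => j ltj; rewrite coef_map /= -rmorphXn mulrC mul_polyC //.
by rewrite coef_poly ltj map_polyZ /= scalerA -scalerAr mulr1.
Qed.

(** * Chern roots *)

Lemma coef_prod_1DX_mesym n k :
  (\prod_(i < n) (1 + 'X_i *: 'X : {poly {mpoly rat[n]}}))`_k = mesym n rat k.
Proof.
under eq_bigr => i _ do rewrite addrC.
rewrite bigA_distr coef_sum /mesym [RHS]big_mkcond; apply: eq_bigr => h _.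
rewrite -big_mkcond scaler_prod prodr_const coefZ coefXn eq_sym.
by case: eqP => _; rewrite ?mulr1 ?mulr0.
Qed.

Lemma coef_prod_1DX_homog (J : finType) (S : pred J) n (l : J -> {mpoly rat[n]}) k :
  (forall i, l i \is 1.-homog) ->
  (\prod_(i | S i) (1 + l i *: 'X))`_k \is k.-homog.
Proof.
move=> hl; pose H (F : {poly {mpoly rat[n]}}) := forall k, F`_k \is k.-homog.
suff: H (\prod_(i | S i) (1 + l i *: 'X)) by apply.
apply: (big_ind H) => [j|F G hF hG j|i _ j].
- by rewrite coef1; case: j => [|j]; rewrite ?dhomog1 ?dhomog0.
- rewrite coefM; apply: rpred_sum => i _.
  by have := dhomogM (hF i) (hG (j - i)%N); rewrite subnKC // -ltnS.
rewrite coefD coef1 coefZ coefX.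
case: j => [|[|j]] /=; rewrite ?mulr0 ?mulr1 ?addr0 ?add0r ?dhomog1 ?dhomog0 //.
Qed.

(** The auxiliary ['X] records the degree: the coefficient of ['X^j] is homogeneous of degree [j],
    and evaluation at 1 forgets the record. *)
Lemma pihomog_prod_1D (J : finType) (S : pred J) n (l : J -> {mpoly rat[n]}) k :
  (forall i, l i \is 1.-homog) ->
  pihomog mdeg k (\prod_(i | S i) (1 + l i)) =
  (\prod_(i | S i) (1 + l i *: 'X))`_k.
Proof.
move=> hl; set F := \prod_(i | S i) (1 + l i *: 'X).
have -> : \prod_(i | S i) (1 + l i) = F.[1].
  rewrite horner_prod; apply: eq_bigr => i _.
  by rewrite hornerD hornerZ hornerX hornerC mulr1.
rewrite (horner_coef_wide _ (leq_maxl (size F) k.+1)) raddf_sum.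
have ltk : (k < maxn (size F) k.+1)%N by rewrite leq_maxr.
rewrite (bigD1 (Ordinal ltk)) //= expr1n mulr1 pihomog_dE ?coef_prod_1DX_homog //.
rewrite big1 ?addr0 // => j nej; rewrite expr1n mulr1.
by rewrite (@pihomog_ne0 _ _ _ j) // coef_prod_1DX_homog.
Qed.

Lemma map_mpoly_pihomog n k (p : {mpoly int[n]}) :
  map_mpoly intr (pihomog mdeg k p) = pihomog mdeg k (map_mpoly intr p) :> {mpoly rat[n]}.
Proof.
set q := map_mpoly _ p.
(* Both projections are written as sums over one common range of monomials. *)
rewrite (pihomogwE _ _ (leq_maxl (msize p) (msize q))).
rewrite (pihomogwE _ _ (leq_maxr (msize p) (msize q))) raddf_sum.
by apply: eq_bigr => m _; rewrite /= map_mpolyZ map_mpolyX mcoeff_map_mpoly.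
Qed.

Definition chern_root n d (alpha : 'X_{1..n < d.+1}) : {mpoly rat[n]} :=
  \sum_(i < n) (alpha i)%:R * 'X_i.

Lemma chern_symQE n d k : chern_symQ n d k =
  (\prod_(alpha : 'X_{1..n < d.+1} | mdeg alpha == d)
     (1 + chern_root alpha *: 'X))`_k.
Proof.
rewrite /chern_symQ map_mpoly_pihomog rmorph_prod /= -pihomog_prod_1D; last first.
  move=> alpha; apply: rpred_sum => i _; rewrite mulr_natl.
  by apply: rpredMn; rewrite dhomogX; apply/eqP; apply: mdeg1.
congr pihomog; apply: eq_bigr => alpha _.
rewrite rmorphD rmorph1 rmorph_sum /=; congr (_ + _); apply: eq_bigr => i _.
by rewrite map_mpolyZ map_mpolyX rmorph_nat scaler_nat mulr_natl.
Qed.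

Lemma sum_bmultinom_deg (V : nmodType) n d (G : ('I_n -> nat) -> V) :
  (forall f g, f =1 g -> G f = G g) ->
  \sum_(alpha : 'X_{1..n < d.+1} | mdeg alpha == d) G alpha =
  \sum_(f : {ffun 'I_n -> 'I_d.+1} | (\sum_i f i == d)%N) G (fun i => nat_of_ord (f i)).
Proof.
move=> extG.
(* The default [bm0] occurs only when the values of [f] sum to more than [d]; the condition
   [fn (mon f) == f] of the reindexing then fails. *)
pose mon (f : {ffun 'I_n -> 'I_d.+1}) : 'X_{1..n < d.+1} :=
  insubd bm0 [multinom (f i : nat) | i < n].
pose fn (alpha : 'X_{1..n < d.+1}) := [ffun i => inord (alpha i) : 'I_d.+1].
have mdegE' (f : {ffun 'I_n -> 'I_d.+1}) : mdeg [multinom (nat_of_ord (f i)) | i < n] = (\sum_i f i)%N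
    :> nat by rewrite mdegE; apply: eq_bigr => i _; rewrite mnmE.
have le_mdeg (alpha : 'X_{1..n}) i : (alpha i <= mdeg alpha)%N.
  by rewrite mdegE (bigD1 i) //= leq_addr.
have fnE alpha i : (fn alpha i : nat) = alpha i.
  by rewrite ffunE inordK // ltnS (leq_trans (le_mdeg alpha i)) // -ltnS bmdeg.
rewrite (reindex_onto mon fn) /=; last first.
  move=> alpha _; apply: val_inj; rewrite val_insubd.
  have -> : [multinom (fn alpha i : nat) | i < n] = alpha.
    by apply/mnmP => i; rewrite mnmE fnE.
  by rewrite bmdeg.
have monE (f : {ffun 'I_n -> 'I_d.+1}) : (\sum_i f i == d)%N -> val (mon f) = [multinom (f i : nat) | i < n].
  by move=> /eqP sf; rewrite val_insubd mdegE' sf ltnSn.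
have fnmon (f : {ffun 'I_n -> 'I_d.+1}) : (\sum_i f i == d)%N -> fn (mon f) = f.
  move=> sf; apply/ffunP => i; apply: val_inj; rewrite /= fnE.
  by rewrite (monE f sf) mnmE.
apply: eq_big => [f|f /andP[/eqP sf /eqP eqf]].
  apply/idP/idP => [/andP[/eqP sf /eqP eqf]|sf].
    apply/eqP; rewrite -[RHS]sf mdegE; apply: eq_bigr => i _.
    by rewrite -[in LHS]eqf fnE.
  by rewrite fnmon // eqxx andbT monE // mdegE'.
by apply: extG => i; rewrite -[in RHS]eqf fnE.
Qed.

(** * Universality of the Chern classes *)

Section UniversalChern.
Variable k : nat.

(* The pair (n, d) stands for n + 1 variables. *)
Definition vars_ring (nd : nat * nat) : comNzRingType := {mpoly rat[nd.1.+1]}.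

Definition eval_Te (nd : nat * nat) : {rmorphism {mpoly rat[k + k]} -> vars_ring nd} :=
  comp_mpoly (Te_tuple nd.1.+1 nd.2 k).

(** The polynomial variable is [u], kept free until [binfun] replaces its powers by the [T_r]. *)
Definition poly_vars_ring (nd : nat * nat) : comNzRingType := {poly {mpoly rat[nd.1.+1]}}.

Definition eval_poly_Te (nd : nat * nat) :
    {rmorphism {poly {mpoly rat[k + k]}} -> poly_vars_ring nd} :=
  map_poly (eval_Te nd).

Local Notation universal_Te := (universal eval_Te).

Lemma eval_Te_scalar nd (c : rat) : eval_Te nd c%:A = c%:A.
Proof. by rewrite /eval_Te /= linearZ rmorph1. Qed.

Lemma universal_mesym r : (r <= k)%N ->
  universal_Te (fun nd => mesym nd.1.+1 rat r).
Proof.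
case: r => [_|r ltrk].
  by apply: eq_universal (universal1 eval_Te) => nd; rewrite mesym0E.
exists 'X_(rshift k (Ordinal ltrk)) => nd /=.
by rewrite comp_mpolyXU -tnth_nth tnth_mktuple (unsplitK (inr _)).
Qed.

Lemma universal_Tbin r : (0 < r <= k)%N ->
  universal_Te (fun nd => 'C(nd.2 + nd.1, nd.1 + r)%:R).
Proof.
case: r => // r ltrk; exists 'X_(lshift k (Ordinal ltrk)) => nd /=.
rewrite comp_mpolyXU -tnth_nth tnth_mktuple (unsplitK (inl _)) /Tvec /Tbin /=.
by rewrite mpolyC_nat; congr ('C(_, _)%:R); lia.
Qed.

Lemma natr_invertible (m : nat) : exists b : {mpoly rat[k + k]}, b * m.+1%:R = 1.
Proof.
exists (m.+1%:R^-1)%:A.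
by rewrite -scalerAl mul1r -scaler_nat scalerA mulVf ?scale1r // Num.Theory.pnatr_eq0.
Qed.

Lemma poly_natr_invertible (m : nat) :
  exists b : {poly {mpoly rat[k + k]}}, b * m.+1%:R = 1.
Proof.
have [b hb] := natr_invertible m; exists b%:P.
by rewrite -polyC_natr -rmorphM /= hb.
Qed.

(** These are Newton's identities; the logarithmic derivative gives the power sum up to the sign
    [(-1) ^+ j], which is multiplied away. *)
Lemma universal_power_sum j : (j < k)%N ->
  universal_Te (fun nd => \sum_(i < nd.1.+1) 'X_i ^+ j.+1).
Proof.
move=> ltjk.
pose F nd : {poly vars_ring nd} :=
  \prod_(i < nd.1.+1) (1 + ('X_i : {mpoly rat[nd.1.+1]}) *: 'X).
pose P nd : {poly vars_ring nd} := \sum_(i < nd.1.+1)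
  \poly_(l < k) ((-1) ^+ l * ('X_i : {mpoly rat[nd.1.+1]}) ^+ l.+1).
have hFP nd : is_logder k (F nd) (P nd).
  by apply: is_logder_prod => i _; apply: is_logder_1DX.
have F0 nd : (F nd)`_0 = 1 by rewrite /F coef_prod_1DX_mesym mesym0E.
have hF l : (l <= k)%N -> universal_Te (fun nd => (F nd)`_l).
  move=> lelk; apply: eq_universal (universal_mesym lelk) => nd.
  by rewrite /F coef_prod_1DX_mesym.
have := universal_logder hFP F0 hF ltjk.
move=> /(universalM (universalC eval_Te ((-1) ^+ j))); apply: eq_universal => nd.
rewrite rmorphXn rmorphN rmorph1 /P coef_sum mulr_sumr; apply: eq_bigr => i _.
by rewrite coef_poly ltjk mulrA -exprMn mulrNN mulr1 expr1n mul1r.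
Qed.

(** The logarithmic derivative of the product has as its coefficient of [t^j] the power sum of
    exponent [j.+1] times the fixed polynomial of index [j] in [Psi]. *)
Lemma universal_coef_genser m : (m <= k)%N ->
  universal eval_poly_Te
    (fun nd => (\prod_(i < nd.1.+1) genser k ('X_i : {mpoly rat[nd.1.+1]}))`_m).
Proof.
move=> lemk; have [Psi hPsi] := logder_genser k.
pose F nd : {poly poly_vars_ring nd} :=
  \prod_(i < nd.1.+1) genser k ('X_i : {mpoly rat[nd.1.+1]}).
pose P nd : {poly poly_vars_ring nd} := \sum_(i < nd.1.+1)
  \poly_(j < k) (('X_i : {mpoly rat[nd.1.+1]}) ^+ j.+1 *:
     map_poly (in_alg {mpoly rat[nd.1.+1]}) Psi`_j).
have hFP nd : is_logder k (F nd) (P nd).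
  by apply: is_logder_prod => i _; apply: hPsi.
have F0 nd : (F nd)`_0 = 1.
  have [s0 c0] := coef_prod_genser k (fun i : 'I_nd.1.+1 => 'X_i : {mpoly rat[nd.1.+1]}) 0.
  by rewrite [LHS](size1_polyC s0) c0.
apply: (universal_of_logder hFP F0 poly_natr_invertible _ lemk) => j ltjk.
have [b hb] := universal_power_sum ltjk.
exists (b *: map_poly (in_alg {mpoly rat[k + k]}) Psi`_j) => nd.
rewrite /eval_poly_Te /= map_polyZ /= -hb /P coef_sum scaler_suml.
apply: eq_bigr => i _; rewrite coef_poly ltjk; congr (_ *: _).
by rewrite -map_poly_comp; apply: eq_map_poly => c; rewrite /= eval_Te_scalar.
Qed.

Lemma universal_chern_power_sum m : (0 < m <= k)%N ->
  universal_Te (fun nd =>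
    \sum_(alpha : 'X_{1..nd.1.+1 < nd.2.+1} | mdeg alpha == nd.2) chern_root alpha ^+ m).
Proof.
move=> /andP[m_gt0 lemk]; have [b hb] := universal_coef_genser lemk.
pose F nd : {poly vars_ring nd} :=
  (\prod_(i < nd.1.+1) genser k ('X_i : {mpoly rat[nd.1.+1]}))`_m.
pose G nd : vars_ring nd :=
  eval_Te nd (m`!%:R) * \sum_(r < k) (F nd)`_r.+1 * 'C(nd.2 + nd.1, nd.1 + r.+1)%:R.
have hFG nd : G nd = \sum_(alpha : 'X_{1..nd.1.+1 < nd.2.+1} | mdeg alpha == nd.2)
    chern_root alpha ^+ m.
  rewrite (@sum_bmultinom_deg _ _ _ (fun f => (\sum_i (f i)%:R * 'X_i) ^+ m)); last first.
    by move=> f g eqfg; congr (_ ^+ m); apply: eq_bigr => i _; rewrite eqfg.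
  rewrite (sum_compositions_expr _ (fun i => 'X_i) lemk) /G rmorph_nat; congr (_ * _).
  have [sF F0] := coef_prod_genser k (fun i : 'I_nd.1.+1 => 'X_i : {mpoly rat[nd.1.+1]}) m.
  (* The term [r = 0] must drop out, as its binomial coefficient is not one of the [T_r]; it does
     since [m > 0]. *)
  rewrite (binfunE _ _ (leq_trans sF (_ : m.+1 <= k.+1)%N)) // big_ord_recl F0.
  by rewrite eqn0Ngt m_gt0 mul0r add0r.
apply: eq_universal hFG _.
apply: (universalM (universalC eval_Te _)).
apply: (@universal_sum _ _ _ _ _ (fun r nd => (F nd)`_r.+1 * 'C(nd.2 + nd.1, nd.1 + r.+1)%:R)).
move=> r; apply: (@universalM _ _ _ _ (fun nd => (F nd)`_r.+1)).
  by exists b`_r.+1 => nd; rewrite /F hb coef_map.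
by apply: universal_Tbin; rewrite /= ltn_ord.
Qed.

(** Newton's identities are now used backwards, from the power sums of the Chern roots to their
    elementary symmetric functions. *)
Lemma universal_chern : universal_Te (fun nd => chern_symQ nd.1.+1 nd.2 k).
Proof.
pose F nd : {poly vars_ring nd} :=
  \prod_(alpha : 'X_{1..nd.1.+1 < nd.2.+1} | mdeg alpha == nd.2) (1 + chern_root alpha *: 'X).
pose P nd : {poly vars_ring nd} :=
  \sum_(alpha : 'X_{1..nd.1.+1 < nd.2.+1} | mdeg alpha == nd.2)
    \poly_(l < k) ((-1) ^+ l * (chern_root alpha) ^+ l.+1).
have hFP nd : is_logder k (F nd) (P nd).
  by apply: is_logder_prod => i _; apply: is_logder_1DX.
have F0 nd : (F nd)`_0 = 1.
  rewrite -horner_coef0 /F horner_prod big1 // => alpha _.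
  by rewrite hornerD hornerC hornerZ hornerX mulr0 addr0.
apply: (@eq_universal _ _ _ _ (fun nd => (F nd)`_k)) => [nd|].
  by rewrite chern_symQE.
apply: (universal_of_logder hFP F0 natr_invertible _ (leqnn k)) => j ltjk.
have := universal_chern_power_sum (ltjk : 0 < j.+1 <= k)%N.
move=> /(universalM (universalC eval_Te ((-1) ^+ j))); apply: eq_universal => nd.
rewrite rmorphXn rmorphN rmorph1 /P coef_sum mulr_sumr; apply: eq_bigr => i _.
by rewrite coef_poly ltjk.
Qed.

End UniversalChern.

(** * Expansion over partitions *)

Section Partitions.
Variable k : nat.
Implicit Types lam mu : intpart k.

Lemma partsP lam :
  [/\ sorted geq (parts lam), forall j, j \in parts lam -> (0 < j <= k)%N
    & sumn (parts lam) = k].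
Proof.
case: lam => s hs; rewrite /parts /=.
have /and3P[sorted_s /allP pos_s /eqP sum_s] := hs; split=> // j js.
by rewrite pos_s //=; case/mapP: js => i _ ->; rewrite -ltnS ltn_ord.
Qed.

Lemma parts_inj : injective (@parts k).
Proof. by move=> lam mu /(inj_map val_inj) /val_inj /val_inj. Qed.

Lemma parts_surj s : sorted geq s -> {in s, forall j, (0 < j)%N} -> sumn s = k ->
  exists lam, parts lam = s.
Proof.
move=> sorted_s pos_s sum_s.
have le_s j : j \in s -> (j <= k)%N.
  by move=> js; rewrite -sum_s sumnE (big_rem j js) leq_addr.
have size_s : (size (map (@inord k) s) <= k)%N.
  rewrite size_map -sum_s sumnE -sum1_size !big_seq; apply: leq_sum => j js.
  exact: pos_s.
have valK : map val (map (@inord k) s) = s.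
  rewrite -map_comp; apply: map_id_in => j /le_s lejk.
  by rewrite /= inordK.
have part_s : is_intpart k (map val (Bseq size_s)).
  by rewrite /is_intpart /= valK sorted_s sum_s eqxx andbT; apply/allP.
by exists (exist _ (Bseq size_s) part_s); rewrite /parts /= valK.
Qed.

(** For [k <= N] this is the exponent vector of [e_lam] as a monomial in [e_1, ..., e_N]; [N = k]
    serves to read off coefficients, [N = n] to prove uniqueness. *)
Definition part_mon N lam : 'X_{1..N} := [multinom count_mem i.+1 (parts lam) | i < N].

Lemma part_mon_inj N : (k <= N)%N -> injective (part_mon N).
Proof.
move=> lekN lam mu eqm; apply: parts_inj.
have [sl hl _] := partsP lam; have [sm hm _] := partsP mu.
apply: (sorted_eq _ _ sl sm) => [a b c|a b|].
- by rewrite /geq /=; lia.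
- by rewrite /geq /=; lia.
apply/allP => j; rewrite mem_cat /= => hj.
have /andP[j_gt0 lejk] : (0 < j <= k)%N by case/orP: hj => [/hl|/hm].
have ltjN : (j.-1 < N)%N by lia.
have /mnmP/(_ (Ordinal ltjN)) := eqm; rewrite !mnmE /= prednK // => ->.
by rewrite eqxx.
Qed.

Lemma big_parts (R : Type) (idx : R) (op : Monoid.com_law idx) N lam (F : nat -> R) :
  (k <= N)%N ->
  \big[op/idx]_(j <- parts lam) F j =
  \big[op/idx]_(i < N) iter (part_mon N lam i) (op (F i.+1)) idx.
Proof.
move=> lekN.
under [RHS]eq_bigr => i _ do rewrite mnmE -big_const_seq.
transitivity (\big[op/idx]_(i < N) \big[op/idx]_(j <- parts lam | j == i.+1) F j).
  rewrite (exchange_big_dep xpredT) //= !big_seq; apply: eq_bigr => j hj.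
  have [_ /(_ j hj) /andP[j_gt0 lejk] _] := partsP lam.
  have ltjN : (j.-1 < N)%N by rewrite prednK // (leq_trans lejk).
  rewrite (big_pred1 (Ordinal ltjN)) // => i.
  by rewrite /= -val_eqE -[RHS]eqSS /= prednK // eq_sym.
by apply: eq_bigr => i _; apply: eq_bigr => j /eqP ->.
Qed.

Lemma mnmwgt_part_mon lam : mnmwgt (part_mon k lam) = k.
Proof.
have [_ _ sum_lam] := partsP lam.
rewrite -[RHS]sum_lam sumnE (big_parts _ _ _ (leqnn k)) /mnmwgt.
by apply: eq_bigr => i _; rewrite iter_addn_0 mulnC.
Qed.

Lemma e_part_mon n N lam : (k <= N)%N ->
  e_part n lam = \prod_(i < N) mesym n rat i.+1 ^+ part_mon N lam i.
Proof.
move=> lekN; rewrite /e_part (big_parts _ _ _ lekN).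
by apply: eq_bigr => i _; rewrite iter_mulr_1.
Qed.

(** The partition has [m i] parts equal to [i.+1], so its size is the weight of [m]. *)
Lemma part_mon_surj (m : 'X_{1..k}) : mnmwgt m = k -> exists lam, part_mon k lam = m.
Proof.
move=> wgt_m.
pose s := flatten [seq nseq (m i) i.+1 | i <- enum 'I_k].
have mem_s j : j \in s -> (0 < j)%N.
  by case/flattenP => _ /mapP[i _ ->]; rewrite mem_nseq => /andP[_ /eqP->].
have sum_s : sumn s = k.
  rewrite -[RHS]wgt_m /s sumn_flatten -map_comp sumnE big_map big_enum /=.
  by apply: eq_bigr => i _; rewrite sumn_nseq mulnC.
have count_s (i : 'I_k) : count_mem i.+1 s = m i.
  rewrite /s count_flatten -map_comp sumnE big_map big_enum /=.
  rewrite (bigD1 i) //= count_nseq /= eqxx mul1n big1 ?addn0 // => j neji.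
  by move: neji; rewrite count_nseq -val_eqE /= eqSS => /negbTE->; rewrite mul0n.
have geq_total : total geq by move=> a b; apply: leq_total.
have [|||lam hlam] := parts_surj (s := sort geq s).
- exact: sort_sorted.
- by move=> j; rewrite mem_sort; apply: mem_s.
- by rewrite -[RHS]sum_s; apply/perm_sumn/permEl/perm_sort.
exists lam; apply/mnmP => i; rewrite mnmE hlam -[RHS]count_s.
by apply/permP/permEl/perm_sort.
Qed.

Section PartCoefficients.
Variable Q : {mpoly rat[k + k]}.

Definition T_mon (m : 'X_{1..k + k}) : 'X_{1..k} := [multinom m (lshift k i) | i < k].
Definition e_mon (m : 'X_{1..k + k}) : 'X_{1..k} := [multinom m (rshift k i) | i < k].

(** With [Q] read as a polynomial in the [z_i] over polynomials in the [u_i], this is the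
    coefficient of the monomial of [lam]. *)
Definition part_coef lam : {mpoly rat[k]} :=
  \sum_(m <- msupp Q | e_mon m == part_mon k lam) Q@_m *: 'X_[T_mon m].

Lemma comp_mpoly_Te n d (m : 'X_{1..k + k}) :
  'X_[m] \mPo Te_tuple n d k =
  'X_[T_mon m].@[@Tvec n d k] *: \prod_(i < k) mesym n rat i.+1 ^+ e_mon m i.
Proof.
rewrite comp_mpolyX big_split_ord /= -mul_mpolyC mevalX rmorph_prod /=.
congr (_ * _); apply: eq_bigr => i _; rewrite mnmE tnth_mktuple.
  by rewrite (unsplitK (inl _)) rmorphXn.
by rewrite (unsplitK (inr _)).
Qed.

Lemma dhomog_prod_mesym n (m : 'X_{1..k}) :
  \prod_(i < k) mesym n rat i.+1 ^+ m i \is (mnmwgt m).-homog.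
Proof.
rewrite /mnmwgt; apply: (big_ind2 (fun (p : {mpoly rat[n]}) w => p \is w.-homog)).
- exact: dhomog1.
- by move=> p v q w; apply: dhomogM.
by move=> i _; rewrite mulnC; apply/dhomogMn/dhomog_mesym.
Qed.

(** Each monomial of [Q] becomes a scalar times a product of [e_i], homogeneous of degree its weight
    in the [z_i]; those of weight [k] are grouped by partition. *)
Lemma pihomog_comp_Te n d :
  pihomog mdeg k (Q \mPo Te_tuple n d k) =
  \sum_lam (part_coef lam).@[@Tvec n d k] *: e_part n lam.
Proof.
pose E m := (Q@_m * 'X_[T_mon m].@[@Tvec n d k]) *:
  \prod_(i < k) mesym n rat i.+1 ^+ e_mon m i.
transitivity (\sum_(m <- msupp Q | mnmwgt (e_mon m) == k) E m).
  rewrite comp_mpolyEX raddf_sum [RHS]big_mkcond /=; apply: eq_bigr => m _.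
  rewrite comp_mpoly_Te scalerA -/(E m).
  case: eqP => [wgt_m|/eqP ne_m].
    rewrite pihomog_dE // rpredZ //.
    by have := dhomog_prod_mesym n (e_mon m); rewrite wgt_m.
  by rewrite (@pihomog_ne0 _ _ _ _ _ _ ne_m) // /E rpredZ // dhomog_prod_mesym.
transitivity (\sum_(m <- msupp Q) \sum_(lam | e_mon m == part_mon k lam) E m).
  rewrite big_mkcond; apply: eq_bigr => m _; case: eqP => [wgt_m|ne_m].
    have [lam hlam] := part_mon_surj wgt_m.
    rewrite (big_pred1 lam) // => mu.
    by rewrite -hlam (inj_eq (part_mon_inj (leqnn k))) eq_sym.
  by rewrite big1 // => lam /eqP eqm; case: ne_m; rewrite eqm mnmwgt_part_mon.
rewrite (exchange_big_dep xpredT) //=; apply: eq_bigr => lam _.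
rewrite raddf_sum /= scaler_suml; apply: eq_bigr => m /eqP eqm.
by rewrite mevalZ /E eqm (e_part_mon _ _ (leqnn k)).
Qed.

End PartCoefficients.

Lemma e_part_unique n (f g : intpart k -> rat) : (k <= n)%N ->
  \sum_lam f lam *: e_part n lam = \sum_lam g lam *: e_part n lam -> f =1 g.
Proof.
move=> lekn eqfg.
(* The expansion is lifted to formal variables in place of the [e_i]; there distinct partitions give
   distinct monomials because [k <= n]. *)
pose t (h : intpart k -> rat) : {mpoly rat[n]} := \sum_lam h lam *: 'X_[part_mon n lam].
have tE h : t h \mPo [tuple mesym n rat i.+1 | i < n] = \sum_lam h lam *: e_part n lam.
  rewrite /t raddf_sum; apply: eq_bigr => lam _ /=.
  rewrite comp_mpolyZ comp_mpolyX (e_part_mon _ _ lekn); congr (_ *: _).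
  by apply: eq_bigr => i _; rewrite tnth_mktuple.
have coef_t h lam : (t h)@_(part_mon n lam) = h lam.
  rewrite /t raddf_sum (bigD1 lam) //= mcoeffZ mcoeffX eqxx mulr1.
  rewrite big1 ?addr0 // => mu ne_mu.
  by rewrite mcoeffZ mcoeffX (inj_eq (part_mon_inj lekn)) (negbTE ne_mu) mulr0.
have eqt : t f = t g by apply: msym_fundamental_un; rewrite !tE.
by move=> lam; rewrite -(coef_t f) eqt coef_t.
Qed.

End Partitions.

Theorem theorem2p4 (k : nat) :
  (exists Q : {mpoly rat[k + k]},
     forall n d : nat, (1 <= n)%N ->
       chern_symQ n d k = Q \mPo (Te_tuple n d k))
  /\
  (exists f : nat -> nat -> intpart k -> rat,
    [/\ forall n d : nat, (1 <= n)%N -> e_expansion n d (f n d),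
        (* for n >= k the coefficients are determined by the expansion *)
        forall n d : nat, (1 <= n)%N -> (k <= n)%N ->
          forall f' : intpart k -> rat, e_expansion n d f' -> f' =1 f n d,
        forall lam : intpart k,
          exists g : {mpoly rat[k]},
            forall n d : nat, (1 <= n)%N -> f n d lam = g.@[@Tvec n d k]
      & forall lam : intpart k,
          exists (m : nat) (a b : 'I_m -> int) (h : {mpoly rat[m]}),
            forall n d : nat, (1 <= n)%N ->
              (forall i : 'I_m, (0 <= d%:Z + n%:Z + a i) /\ (0 <= n%:Z + b i))
              /\
              f n d lam =
                h.@[fun i => ('C(absz (d%:Z + n%:Z + a i), absz (n%:Z + b i)))%:R]]).
Proof.
have [Q hQ] := universal_chern k.
have chernE n d : (1 <= n)%N -> chern_symQ n d k = Q \mPo Te_tuple n d k.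
  by case: n => // n _; rewrite (hQ (n, d)).
split; first by exists Q.
have expand n d : (1 <= n)%N ->
    e_expansion n d (fun lam => (part_coef Q lam).@[@Tvec n d k]).
  move=> n_gt0; rewrite /e_expansion -pihomog_comp_Te -chernE //.
  (* The Chern class is itself a homogeneous part, so projecting again changes nothing. *)
  by rewrite /chern_symQ map_mpoly_pihomog pihomog_id.
exists (fun n d lam => (part_coef Q lam).@[@Tvec n d k]); split=> //.
- move=> n d n_gt0 lekn f' hf'; apply: (e_part_unique lekn).
  by rewrite -(expand n d n_gt0) hf'.
- by move=> lam; exists (part_coef Q lam).
(* The index [i] stands for [r = i + 1], so the lower entry [n + r - 1] is [n + i]. *)
move=> lam; exists k, (fun => -1), (fun i => (i : nat)%:Z), (part_coef Q lam).
move=> n d n_gt0; split=> [i|]; first by split; lia.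
apply: meval_eq => i; rewrite /Tvec /Tbin; congr ('C(_, _)%:R); lia.
Qed.
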